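(* Let $(X,\mathcal{A},\mu)$ be a measure space with $X$ nonempty and $\mu$ a positive measure that is not identically zero, and write $L^r = L^r(X,\mathcal{A},\mu)$. Let $1 < p < \infty$ and denote by $q:= p/(p - 1)$ its conjugate exponent. Let $C_1\subset L^p$ and $C_2\subset L^q$ be cones, let $S(L^p)$ stand for the unit sphere of $L^p$, and let $\overline{|C_1|}$ and $\overline{|C_2|}$ denote the topological closures of $|C_1|$ in $L^p$ and of $|C_2|$ in $L^q$, respectively. If $\overline{|C_1|}\cap S(L^p)$ is norm compact, and $\psi_{p,2} (\overline{|C_1|}) \cap \psi_{q,2} (\overline{|C_2|}) = \{0\}$, then there exists a constant $\gamma = \gamma (C_1, C_2)\in [0,1)$ such that for every $f\in C_1$ and every $g\in C_2$, $$\|fg\|_1 \le \gamma \|f\|_p \|g\|_q.$$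
   Context: $L^r$ consists of (classes of) complex-valued functions, with the usual norm $\|\cdot\|_r$. A subset $C$ of a vector space over a field containing the real numbers is a cone if for every $x\in C$ and every real $\lambda>0$ we have $\lambda x\in C$. For a subset $A\subset L^r$, $|A| := \{|f| : f\in A\}$. For $z = \rho e^{i\theta}\neq 0$ (with $\rho>0$) put $\operatorname{sign} z = e^{i\theta}$, and put $\operatorname{sign} 0 = 1$. The Mazur map $\psi_{r,s}: L^r\to L^s$ (for $1<r,s<\infty$) is defined on the unit sphere of $L^r$ by $\psi_{r,s}(f) := |f|^{r/s}\operatorname{sign} f$ and extended to the rest of $L^r$ by homogeneity: for $f\neq 0$, $\psi_{r,s}(f) := \|f\|_r\,\psi_{r,s}(f/\|f\|_r) = \|f\|_r^{1-r/s}|f|^{r/s}\operatorname{sign} f$, and $\psi_{r,s}(0)=0$. *)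

(* Defs.v *)
From HB Require Import structures.
From mathcomp Require Import all_boot all_order all_algebra ring_quotient.
From mathcomp Require Import complex.
From mathcomp Require Import all_classical all_reals all_analysis.
From mathcomp Require Import measurable_realfun.

Set Implicit Arguments.
Unset Strict Implicit.
Unset Printing Implicit Defensive.

Import Order.TTheory GRing.Theory Num.Theory.
Import numFieldNormedType.Exports.

Local Open Scope classical_set_scope.
Local Open Scope ring_scope.
Local Open Scope quotient_scope.

(* Complex numbers are [Rcomplex R]: the type [R[i]] seen as a real vector
   space, on which the modulus [`|z|] takes its values in [R]. *)

(* The Borel sigma-algebra of C = R^2 is the product one, so measurability is
   that of the real and imaginary parts. *)
Definition cmeasurable d (T : measurableType d) (R : realType)
    (f : T -> Rcomplex R) : Prop :=
  measurable_fun [set: T] (fun x => complex.Re (f x)) /\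
  measurable_fun [set: T] (fun x => complex.Im (f x)).

Definition cLnorm d (T : measurableType d) (R : realType)
    (mu : {measure set T -> \bar R}) (r : R) (f : T -> Rcomplex R) : \bar R :=
  Lnorm mu r%:E (fun x => `|f x|%:E).

Section cLnorm_theory.
Context d (T : measurableType d) (R : realType).
Variable mu : {measure set T -> \bar R}.
Implicit Types (f g : T -> Rcomplex R) (r : R).

Lemma normcE (z : Rcomplex R) :
  `|z| = Num.sqrt (complex.Re z ^+ 2 + complex.Im z ^+ 2).
Proof. by case: z. Qed.

Lemma normcZ (a : R) (z : Rcomplex R) : `|a *: z| = `|a| * `|z|.
Proof.
case: z => b c; rewrite !normcE /= !exprMn -mulrDr sqrtrM ?sqr_ge0//.
by rewrite sqrtr_sqr.
Qed.

Lemma normc_real (a : R) : `|(a%:C)%C : Rcomplex R| = `|a|.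
Proof. by rewrite normcE /= expr0n addr0 sqrtr_sqr. Qed.

Lemma cmeasurable_norm f :
  cmeasurable f -> measurable_fun [set: T] (fun x => `|f x|).
Proof.
move=> [mR mI].
rewrite (_ : (fun x => _) = (fun x => (complex.Re (f x) ^+ 2 + complex.Im (f x) ^+ 2) `^ 2^-1)).
  apply: (measurableT_comp (measurable_powR _)) => //.
  by apply: measurable_funD; exact: measurable_funX.
apply/funext => x; rewrite normcE powR12_sqrt//.
by rewrite addr_ge0// sqr_ge0.
Qed.

Lemma cmeasurable_scale (h : T -> R) f : measurable_fun [set: T] h ->
  cmeasurable f -> cmeasurable (fun x => h x *: f x).
Proof.
move=> mh [mR mI]; split.
  rewrite (_ : (fun x => _) = (fun x => h x * complex.Re (f x))).
    exact: measurable_funM.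
  by apply/funext => x; case: (f x).
rewrite (_ : (fun x => _) = (fun x => h x * complex.Im (f x))).
  exact: measurable_funM.
by apply/funext => x; case: (f x).
Qed.

Lemma cmeasurableD f g :
  cmeasurable f -> cmeasurable g -> cmeasurable (fun x => f x + g x).
Proof.
move=> [mR mI] [mR' mI']; split.
  rewrite (_ : (fun x => _) = (fun x => complex.Re (f x) + complex.Re (g x))).
    exact: measurable_funD.
  by apply/funext => x; case: (f x); case: (g x).
rewrite (_ : (fun x => _) = (fun x => complex.Im (f x) + complex.Im (g x))).
  exact: measurable_funD.
by apply/funext => x; case: (f x); case: (g x).
Qed.

Lemma cLnormE r f : r != 0 ->
  cLnorm mu r f = ((\int[mu]_x ((`|f x| `^ r)%:E)) `^ r^-1)%E.
Proof.
move=> r0; rewrite /cLnorm unlock /=; congr poweR; apply: eq_integral => x _.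
by rewrite normr_id.
Qed.

Lemma cLnorm_poweR r f : r != 0 ->
  (cLnorm mu r f `^ r = \int[mu]_x ((`|f x| `^ r)%:E))%E.
Proof.
move=> r0; rewrite /cLnorm poweR_Lnorm//; apply: eq_integral => x _.
by rewrite /= normr_id.
Qed.

Lemma cLnormD r f g : 1 <= r -> cmeasurable f -> cmeasurable g ->
  (cLnorm mu r (fun x => (f x + g x)%R) <= cLnorm mu r f + cLnorm mu r g)%E.
Proof.
move=> r1 mf mg.
have r0 : r != 0 by rewrite gt_eqF// (lt_le_trans ltr01).
have := minkowski_EFin mu (cmeasurable_norm mf) (cmeasurable_norm mg) r1.
apply: le_trans; rewrite /cLnorm !unlock /=.
apply: gt0_ler_poweR; rewrite ?invr_ge0 ?(le_trans ler01)//.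
- by rewrite in_itv/= leey andbT; apply: integral_ge0 => x _; rewrite lee_fin powR_ge0.
- by rewrite in_itv/= leey andbT; apply: integral_ge0 => x _; rewrite lee_fin powR_ge0.
apply: ge0_le_integral => //.
- apply/measurable_EFinP/(measurableT_comp (measurable_powR _)) => //.
  by apply: measurableT_comp => //; exact/cmeasurable_norm/cmeasurableD.
- apply/measurable_EFinP/(measurableT_comp (measurable_powR _)) => //.
  apply: measurableT_comp => //.
  by apply: measurable_funD; exact: cmeasurable_norm.
move=> x _; rewrite lee_fin (ge0_ler_powR (le_trans ler01 r1)) ?nnegrE//.
by rewrite normr_id (ger0_norm (addr_ge0 (normr_ge0 _) (normr_ge0 _))) ler_normD.
Qed.

Lemma cLnormZ r (a : R) f : 1 <= r -> cmeasurable f ->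
  (cLnorm mu r (fun x => (a *: f x)%R) = `|a|%:E * cLnorm mu r f)%E.
Proof.
move=> r1 mf; have r0 : 0 < r by rewrite (lt_le_trans ltr01).
rewrite !cLnormE ?gt_eqF//.
have -> : (\int[mu]_x (`|a *: f x| `^ r)%:E =
    \int[mu]_x ((`|a| `^ r)%:E * (`|f x| `^ r)%:E))%E.
  by apply: eq_integral => x _; rewrite normcZ powRM.
rewrite ge0_integralZl_EFin //=.
- rewrite poweRM ?lee_fin ?powR_ge0//; last first.
    by apply: integral_ge0 => x _; rewrite lee_fin powR_ge0.
  by rewrite poweR_EFin -powRrM mulfV ?gt_eqF// powRr1.
- apply/measurable_EFinP/(measurableT_comp (measurable_powR _)) => //.
  exact: cmeasurable_norm.
Qed.

Lemma cLnorm_ae r f g : f = g %[ae mu] ->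
  cmeasurable f -> cmeasurable g -> r != 0 ->
  cLnorm mu r f = cLnorm mu r g.
Proof.
move=> fg mf mg r0; rewrite !cLnormE//; congr poweR.
have m h : cmeasurable h -> measurable_fun [set: T] (fun x => (`|h x| `^ r)%:E).
  move=> mh; apply/measurable_EFinP/(measurableT_comp (measurable_powR _)) => //.
  exact: cmeasurable_norm.
apply: ge0_ae_eq_integral => //; try exact: m.
by apply: filterS fg => x /(_ I) ->.
Qed.

Lemma cLnorm_eq0 r f : 0 < r -> cmeasurable f ->
  cLnorm mu r f = 0%E -> f = cst 0 %[ae mu].
Proof.
move=> r0 mf /Lnorm_eq0_eq0 h.
have {}h := h _ (r0 : (0 < r%:E)%E).
have /h : measurable_fun [set: T] (fun x => `|f x|%:E).
  exact/measurable_EFinP/cmeasurable_norm.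
by apply: filterS => x /(_ I) [] /= /eqP; rewrite normr_eq0 => /eqP.
Qed.

End cLnorm_theory.

Section Lc.
Context d (T : measurableType d) (R : realType).
Variables (mu : {measure set T -> \bar R}) (r : R).

Definition Lcfun_pred (r1 : 1 < r) : {pred T -> Rcomplex R} :=
  fun f => `[< cmeasurable f /\ (cLnorm mu r f < +oo)%E >].

Variable r1 : 1 < r.
Let r0 : 0 < r := lt_trans ltr01 r1.
Local Notation C := (Rcomplex R).

Lemma Lcfun_predP (f : T -> C) :
  reflect (cmeasurable f /\ (cLnorm mu r f < +oo)%E) (f \in Lcfun_pred r1).
Proof. exact: asboolP. Qed.

Lemma Lcfun_submod_closed : submod_closed (Lcfun_pred r1).
Proof.
split.
  apply/Lcfun_predP; split; first by split; exact: measurable_cst.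
  rewrite cLnormE ?gt_eqF//.
  under eq_integral do rewrite normr0 powR0 ?gt_eqF//.
  by rewrite integral0 poweR0r ?ltry// invr_eq0 gt_eqF.
move=> a f g /Lcfun_predP[mf ff] /Lcfun_predP[mg fg]; apply/Lcfun_predP.
have maf : cmeasurable (fun x => a *: f x).
  exact: (cmeasurable_scale (measurable_cst a)).
split; first exact: cmeasurableD.
apply: (le_lt_trans (cLnormD mu (ltW r1) maf mg)).
rewrite lte_add_pinfty// cLnormZ ?(ltW r1)//.
by rewrite lte_mul_pinfty// lee_fin.
Qed.

HB.instance Definition _ := GRing.isSubmodClosed.Build R (T -> C)
  (Lcfun_pred r1) Lcfun_submod_closed.

Record Lcfun := LcFun {
  Lcfun_fun :> T -> C;
  Lcfun_prop : Lcfun_fun \in Lcfun_pred r1 }.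

HB.instance Definition _ := [isSub for Lcfun_fun].
HB.instance Definition _ := [Choice of Lcfun by <:].
HB.instance Definition _ := [SubChoice_isSubLmodule of Lcfun by <:].

Lemma Lcfun_measurable (f : Lcfun) : cmeasurable f.
Proof. by have /Lcfun_predP[] := Lcfun_prop f. Qed.

Lemma Lcfun_finite (f : Lcfun) : (cLnorm mu r f < +oo)%E.
Proof. by have /Lcfun_predP[] := Lcfun_prop f. Qed.

Definition Lcnull : {pred Lcfun} :=
  fun f => `[< (f : T -> C) = cst 0 %[ae mu] >].

Lemma Lcnull_zmod_closed : zmod_closed Lcnull.
Proof.
split; first by apply/asboolP; apply: nearW.
move=> f g /asboolP f0 /asboolP g0; apply/asboolP.
apply: filterS2 f0 g0 => x /(_ I) fx /(_ I) gx _.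
by rewrite -[LHS]/(f x - g x) fx gx subrr.
Qed.

HB.instance Definition _ := GRing.isZmodClosed.Build Lcfun Lcnull
  Lcnull_zmod_closed.

(* The space L^r of complex-valued functions modulo equality almost everywhere.
   Only its underlying real normed space is recorded: the norm, its topology and
   multiplication by real scalars are the same as over C. *)
Definition Lc : Type := {ideal_quot Lcnull}.
HB.instance Definition _ := GRing.Zmodule.on Lc.
HB.instance Definition _ := ZmodQuotient.on Lc.

Definition Lc_fun (u : Lc) : T -> C := repr u.
Coercion Lc_fun : Lc >-> Funclass.

Definition Lc_class (f : T -> C) (fP : f \in Lcfun_pred r1) : Lc :=
  \pi_Lc (LcFun fP).

Lemma Lc_eqP (f g : Lcfun) :
  (\pi_Lc f = \pi_Lc g) <-> (f : T -> C) = g %[ae mu].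
Proof.
split.
  move/eqP; rewrite -Quotient.idealrBE => /asboolP; apply: filterS => x.
  move=> /[apply]; rewrite -[_ x]/(f x - g x) => /eqP.
  by rewrite subr_eq0 => /eqP.
move=> fg; apply/eqP; rewrite -Quotient.idealrBE; apply/asboolP.
apply: filterS fg => x /[apply] fgx.
by rewrite -[LHS]/(f x - g x) fgx subrr.
Qed.

Lemma Lc_repr (f : Lcfun) : (\pi_Lc f : Lc) = f %[ae mu].
Proof. by apply/Lc_eqP; rewrite reprK. Qed.

Definition Lc_scale (a : R) (u : Lc) : Lc := \pi_Lc (a *: repr u).

Lemma pi_Lc_scale a f : \pi_Lc (a *: f) = Lc_scale a (\pi_Lc f).
Proof.
apply/Lc_eqP; have := Lc_repr f; apply: filterS => x /[apply] fx.
by rewrite -[LHS]/(a *: f x) -fx.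
Qed.

Lemma Lc_scaleA a b u : Lc_scale a (Lc_scale b u) = Lc_scale (a * b) u.
Proof.
elim/quotW: u => u; rewrite -(pi_Lc_scale b u) -(pi_Lc_scale a (b *: u)).
by rewrite -(pi_Lc_scale (a * b) u) scalerA.
Qed.

Lemma Lc_scale1 : left_id 1 Lc_scale.
Proof. by elim/quotW => u; rewrite -(pi_Lc_scale 1 u) scale1r. Qed.

Lemma Lc_scaleDr : right_distributive Lc_scale +%R.
Proof.
move=> a; elim/quotW => u; elim/quotW => v; rewrite -raddfD.
rewrite -(pi_Lc_scale a u) -(pi_Lc_scale a v) -(pi_Lc_scale a (u + v)).
by rewrite -raddfD scalerDr.
Qed.

Lemma Lc_scaleDl u : {morph Lc_scale^~ u : a b / a + b}.
Proof.
move=> a b; elim/quotW: u => u.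
rewrite -(pi_Lc_scale a u) -(pi_Lc_scale b u) -(pi_Lc_scale (a + b) u).
by rewrite -raddfD scalerDl.
Qed.

HB.instance Definition _ := GRing.Zmodule_isLmodule.Build R Lc
  Lc_scaleA Lc_scale1 Lc_scaleDr Lc_scaleDl.

Definition Lc_norm (u : Lc) : R := fine (cLnorm mu r u).

Lemma Lc_normE u : (Lc_norm u)%:E = cLnorm mu r u.
Proof.
by rewrite /Lc_norm fineK// ge0_fin_numE ?Lnorm_ge0//; exact: Lcfun_finite.
Qed.

Lemma Lc_norm_pi (f : Lcfun) : (Lc_norm (\pi_Lc f))%:E = cLnorm mu r f.
Proof.
rewrite Lc_normE; apply: (cLnorm_ae (Lc_repr f)).
- exact: Lcfun_measurable.
- exact: Lcfun_measurable.
- by rewrite gt_eqF.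
Qed.

Lemma Lc_normD u v : Lc_norm (u + v) <= Lc_norm u + Lc_norm v.
Proof.
rewrite -lee_fin EFinD -[u]reprK -[v]reprK -raddfD !Lc_norm_pi.
by apply: cLnormD (ltW r1) _ _; exact: Lcfun_measurable.
Qed.

Lemma Lc_normZ a u : Lc_norm (a *: u) = `|a| * Lc_norm u.
Proof.
apply: EFin_inj; rewrite EFinM -[u]reprK.
rewrite [a *: _](esym (pi_Lc_scale a (repr u))) !Lc_norm_pi.
by apply: cLnormZ (ltW r1) _; exact: Lcfun_measurable.
Qed.

Lemma Lc_norm_eq0 u : Lc_norm u = 0 -> u = 0.
Proof.
move=> u0; rewrite -[u]reprK -(raddf0 \pi_Lc); apply/Lc_eqP.
apply: (cLnorm_eq0 r0); first exact: Lcfun_measurable.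
by rewrite -Lc_normE u0.
Qed.

HB.instance Definition _ := Lmodule_isNormed.Build R Lc
  Lc_normD Lc_normZ Lc_norm_eq0.

Lemma Lc_absP (u : Lc) : (fun x => (`|u x|%:C)%C) \in Lcfun_pred r1.
Proof.
apply/Lcfun_predP; split.
  split; last exact: measurable_cst.
  exact/cmeasurable_norm/Lcfun_measurable.
rewrite (le_lt_trans _ (Lcfun_finite (repr u)))// le_eqVlt; apply/orP; left.
by apply/eqP; apply: eq_Lnorm => x /=; rewrite normc_real normr_id.
Qed.

Definition Lc_abs (u : Lc) : Lc := Lc_class (Lc_absP u).

End Lc.

Arguments Lc {d T R} mu {r} r1.
Arguments Lc_abs {d T R mu r r1} u.

Definition csign (R : realType) (z : Rcomplex R) : Rcomplex R :=
  if z == 0 then 1 else `|z|^-1 *: z.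

Section mazur.
Context d (T : measurableType d) (R : realType).
Variables (mu : {measure set T -> \bar R}).
Variables (r s : R) (r1 : 1 < r) (s1 : 1 < s).

Lemma mazur_sphereP (u : Lc mu r1) :
  (fun x => (`|u x| `^ (r / s)) *: csign (u x)) \in Lcfun_pred mu s1.
Proof.
have r0 : 0 < r := lt_trans ltr01 r1.
have s0 : 0 < s := lt_trans ltr01 s1.
have mu_ : cmeasurable u := Lcfun_measurable (repr u).
have mn := cmeasurable_norm mu_.
apply/Lcfun_predP; split.
  rewrite (_ : (fun x => _) =
      (fun x => (`|u x| `^ (r / s) * `|u x| `^ (- 1)) *: u x)); last first.
    apply/funext => x; rewrite /csign powR_inv1//; case: eqP => [->|_].
      by rewrite normr0 powR0 ?mul0r ?scale0r// mulf_neq0 ?invr_eq0 ?gt_eqF.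
    by rewrite scalerA.
  apply: cmeasurable_scale => //; apply: measurable_funM.
    exact: (measurableT_comp (measurable_powR _)).
  exact: (measurableT_comp (measurable_powR _)).
have /(poweR_lty r) := Lcfun_finite (repr u).
rewrite cLnorm_poweR ?gt_eqF// => fin.
rewrite cLnormE ?gt_eqF//; apply: poweR_lty; apply: le_lt_trans fin.
rewrite le_eqVlt; apply/orP; left; apply/eqP/eq_integral => x _; congr EFin.
rewrite normcZ ger0_norm ?powR_ge0// powRM ?powR_ge0// -powRrM.
rewrite divfK ?gt_eqF// -[repr u x]/(u x) /csign; case: eqP => [->|/eqP ux0].
  by rewrite normr0 powR0 ?gt_eqF// mul0r.
rewrite normcZ ger0_norm ?invr_ge0// mulVf ?normr_eq0//.
by rewrite powR1 mulr1.
Qed.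

(* Meant for the unit sphere; [mazur] extends it from there by homogeneity. *)
Definition mazur_sphere (u : Lc mu r1) : Lc mu s1 := Lc_class (mazur_sphereP u).

Definition mazur (u : Lc mu r1) : Lc mu s1 :=
  if u == 0 then 0 else `|u| *: mazur_sphere (`|u|^-1 *: u).

End mazur.
Arguments mazur {d T R mu r s r1} s1 u.

Definition is_cone (R : realType) (V : lmodType R) (C : set V) : Prop :=
  forall x (lambda : R), C x -> 0 < lambda -> C (lambda *: x).

Definition unit_sphere (R : realType) (V : normedModType R) : set V :=
  [set x | `|x| = 1].
Arguments unit_sphere {R} V.

Lemma conjugate_gt1 (R : realType) (p : R) : 1 < p -> 1 < p / (p - 1).
Proof. by move=> p1; rewrite ltr_pdivlMr ?subr_gt0// mul1r gtrBl. Qed.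

Lemma gt1_2 (R : realType) : 1 < 2 :> R.
Proof. by rewrite ltr1n. Qed.

(* Main.v *)
(* Hoelder's inequality is stable: for unit vectors u, v >= 0 of L^p and L^q,
   if the integral of u v is close to 1 then v is close to u^(p/q), the Mazur
   image of u.  This comes from integrating a Young inequality whose remainder
   is the square of a^(p/2) - b^(q/2).  If no gamma < 1 worked, normalized pairs
   (f, g) in C1 x C2 would have ||f g||_1 arbitrarily close to 1; by compactness
   the |f| cluster at a unit vector w of the closure of |C1|, and by stability
   the |g| cluster at w^(p/q), which thus lies in the closure of |C2|.  The
   images of w and w^(p/q) in L^2 are the same unit vector, contradicting the
   trivial intersection. *)
Require Import Defs.
From HB Require Import structures.
From mathcomp Require Import all_boot all_order all_algebra ring_quotient.
From mathcomp Require Import complex.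
From mathcomp Require Import all_classical all_reals all_analysis.
From mathcomp Require Import measurable_realfun.
From mathcomp Require Import ring lra.

Set Implicit Arguments.
Unset Strict Implicit.
Unset Printing Implicit Defensive.

Import Order.TTheory GRing.Theory Num.Theory.
Import numFieldNormedType.Exports.

Local Open Scope classical_set_scope.
Local Open Scope ring_scope.

(** * Pointwise refinements of Young's inequality *)

Section pointwise.
Context {R : realType}.
Implicit Types a b h p q t eps : R.

Lemma powR_le_cancel t a b : 0 < t -> 0 <= a -> 0 <= b ->
  a `^ t <= b `^ t -> a <= b.
Proof.
move=> t0 a0 b0 ab; rewrite leNgt; apply/negP => ba.
by have := gt0_ltr_powR t0 b0 a0 ba; rewrite ltNge ab.
Qed.

(** Young's inequality for [a^t] and [b^(1-t)] with exponents [1/t] and [1/(1-t)]; the endpoints,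
    where an exponent would be infinite, are treated apart. *)
Lemma weighted_am_gm a b t : 0 <= a -> 0 <= b -> 0 <= t <= 1 ->
  a `^ t * b `^ (1 - t) <= t * a + (1 - t) * b.
Proof.
move=> a0 b0 /andP[]; rewrite le_eqVlt => /predU1P[<- _|t0].
  by rewrite powRr0 subr0 powRr1// mul0r add0r.
rewrite le_eqVlt => /predU1P[->|t1].
  by rewrite subrr powRr0 powRr1// mul0r addr0 mul1r mulr1.
have t1' : 0 < 1 - t by rewrite subr_gt0.
have := @conjugate_powR _ (a `^ t) (b `^ (1 - t)) t^-1 (1 - t)^-1
  (powR_ge0 _ _) (powR_ge0 _ _).
rewrite !invr_gt0 !invrK -!powRrM !divff ?gt_eqF// !powRr1//.
move=> /(_ t0 t1'); rewrite (mulrC a) (mulrC b); apply; lra.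
Qed.

(** With the factor [1/p] the [a^p] terms cancel once the square is expanded, and [2 <= p] makes
    [2/p] an admissible weight for the remaining mean inequality. *)
Lemma young_refined_ge2 a b p q : 0 <= a -> 0 <= b -> 2 <= p -> 0 < q ->
  p^-1 + q^-1 = 1 ->
  p^-1 * (a `^ (p / 2) - b `^ (q / 2)) ^+ 2
    <= a `^ p / p + b `^ q / q - a * b.
Proof.
move=> a0 b0 p2 q0 pq; have p0 : 0 < p by lra.
have sq c r : (c `^ (r / 2)) ^+ 2 = c `^ r.
  by rewrite -powR_mulrn ?powR_ge0// -powRrM divfK.
have t01 : 0 <= 2 / p <= 1.
  by rewrite divr_ge0 ?(ltW p0)//= ler_pdivrMr// mul1r.
(* With A = a^(p/2) and B = b^(q/2), the claim reduces to
   (A B)^(2/p) (B^2)^(1 - 2/p) <= (2/p) A B + (1 - 2/p) B^2. *)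
have := weighted_am_gm (mulr_ge0 (powR_ge0 a (p / 2)) (powR_ge0 b (q / 2)))
  (powR_ge0 b q) t01.
have -> : (a `^ (p / 2) * b `^ (q / 2)) `^ (2 / p) * (b `^ q) `^ (1 - 2 / p) =
    a * b.
  rewrite powRM ?powR_ge0// -!powRrM.
  have -> : p / 2 * (2 / p) = 1 by field; rewrite gt_eqF.
  rewrite powRr1// -mulrA; congr (_ * _).
  have e : q / 2 * (2 / p) + q * (1 - 2 / p) = 1.
    rewrite (_ : _ + _ = q * (1 - p^-1)); last by field; rewrite gt_eqF.
    by rewrite -pq addrC addKr divff// gt_eqF.
  rewrite -powRD; first by rewrite e powRr1.
  by rewrite e oner_eq0.
rewrite sqrrB !sq => h.
have -> : q^-1 = 1 - p^-1 by rewrite -pq addrC addKr.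
nra.
Qed.

(** One of two conjugate exponents is at least 2, so up to exchanging the roles of [(a, p)] and
    [(b, q)] the previous case applies; [1/(pq)] is a symmetric constant below both [1/p] and
    [1/q]. *)
Lemma young_refined a b p q : 0 <= a -> 0 <= b -> 1 < p -> 1 < q ->
  p^-1 + q^-1 = 1 ->
  (p * q)^-1 * (a `^ (p / 2) - b `^ (q / 2)) ^+ 2
    <= a `^ p / p + b `^ q / q - a * b.
Proof.
wlog p2 : a b p q / 2 <= p => [wlg|] a0 b0 p1 q1 pq.
  have [p2|p2] := leP 2 p; first exact: wlg.
  have q2 : 2 <= q.
    have : 2^-1 <= p^-1 by rewrite lef_pV2 ?posrE//; lra.
    move=> h; have : q^-1 <= 2^-1 by lra.
    by rewrite lef_pV2 ?posrE//; lra.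
  have := wlg b a q p q2 b0 a0 q1 p1.
  rewrite addrC => /(_ pq); rewrite (mulrC q) (mulrC b a) -sqrrN opprB.
  by rewrite (addrC (b `^ q / q)).
have p0 : 0 < p by lra.
have q0 : 0 < q by lra.
apply: le_trans (young_refined_ge2 a0 b0 p2 q0 pq).
rewrite ler_wpM2r ?sqr_ge0// lef_pV2 ?posrE ?mulr_gt0//.
by rewrite ler_peMr ?ltW.
Qed.

(* If b <= (1 + dl) a then |b - a|^q <= dl^q a^q; otherwise a^(q/2) is at most
   eta b^(q/2) for some eta < 1, and the square dominates b^q. *)
Lemma powR_dist_le q eps : 0 < q -> 0 < eps -> exists2 C, 0 <= C &
  forall a b, 0 <= a -> 0 <= b ->
  `|b - a| `^ q <= eps * (a `^ q + b `^ q) +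
                   C * (a `^ (q / 2) - b `^ (q / 2)) ^+ 2.
Proof.
move=> q0 eps0; pose dl := eps `^ q^-1; have dl0 : 0 < dl by exact: powR_gt0.
have d1 : 0 < 1 + dl by lra.
have dq : dl `^ q = eps by rewrite -powRrM mulVf ?gt_eqF// powRr1// ltW.
pose eta := (1 + dl)^-1 `^ (q / 2).
have q20 : 0 < q / 2 by rewrite divr_gt0.
have eta1 : eta < 1.
  have <- : 1 `^ (q / 2) = 1 :> R by rewrite powR1.
  rewrite /eta gt0_ltr_powR ?nnegrE ?invr_ge0 ?(ltW d1)//.
  by rewrite invf_lt1//; lra.
have eta1' : 0 < 1 - eta by lra.
have sq c r : (c `^ (r / 2)) ^+ 2 = c `^ r.
  by rewrite -powR_mulrn ?powR_ge0// -powRrM divfK.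
(* When [a^(q/2) <= eta b^(q/2)], the difference of these powers is at least [(1 - eta) b^(q/2)];
   squaring gives this constant. *)
exists ((1 - eta) ^- 2); first by rewrite invr_ge0 sqr_ge0.
move=> a b; wlog ab : a b / a <= b => [wlg|] a0 b0.
  have [ab|/ltW ab] := leP a b; first exact: wlg.
  have := wlg b a ab b0 a0.
  by rewrite distrC (addrC (b `^ q)) -[(b `^ _ - _) ^+ 2]sqrrN opprB.
rewrite ger0_norm ?subr_ge0//.
have a'0 : 0 <= a `^ q by exact: powR_ge0.
have b'0 : 0 <= b `^ q by exact: powR_ge0.
have [bd|bd] := leP b ((1 + dl) * a).
  have : (b - a) `^ q <= eps * a `^ q.
    rewrite -dq -powRM ?(ltW dl0)//.
    rewrite (ge0_ler_powR (ltW q0)) ?nnegrE ?subr_ge0 ?mulr_ge0 ?(ltW dl0)//.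
    lra.
  have : 0 <= (1 - eta) ^- 2 * (a `^ (q / 2) - b `^ (q / 2)) ^+ 2.
    by rewrite mulr_ge0 ?invr_ge0 ?sqr_ge0.
  nra.
have h1 : (b - a) `^ q <= b `^ q.
  by rewrite (ge0_ler_powR (ltW q0)) ?nnegrE ?subr_ge0//; lra.
have h2 : a `^ (q / 2) <= eta * b `^ (q / 2).
  rewrite -powRM ?invr_ge0 ?(ltW d1)//.
  rewrite (ge0_ler_powR (ltW q20)) ?nnegrE ?mulr_ge0 ?invr_ge0 ?(ltW d1)//.
  by rewrite mulrC ler_pdivlMr// mulrC ltW.
have h3 : b `^ q <= (1 - eta) ^- 2 * (a `^ (q / 2) - b `^ (q / 2)) ^+ 2.
  rewrite mulrC ler_pdivlMr ?exprn_gt0// -sq -exprMn -[leRHS]sqrrN opprB.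
  rewrite ler_sqr ?nnegrE; first by lra.
    by rewrite mulr_ge0 ?powR_ge0// ltW.
  by have : 0 <= b `^ (q / 2) by [exact: powR_ge0]; nra.
nra.
Qed.

(** The distance estimate is applied to [a^(p/q)] and [b], and its square is bounded by [pq] times
    the Young defect. The product [a b] stands on the left so that every term is nonnegative and can
    be integrated without subtraction. *)
Lemma hoelder_defect_pointwise p q eps : 1 < p -> 1 < q ->
  p^-1 + q^-1 = 1 -> 0 < eps -> exists2 C, 0 <= C &
  forall a b, 0 <= a -> 0 <= b ->
  `|b - a `^ (p / q)| `^ q + C * (a * b)
    <= (eps + C / p) * a `^ p + (eps + C / q) * b `^ q.
Proof.
move=> p1 q1 pq eps0; have q0 : 0 < q by lra.
have pq0 : 0 < p * q by apply: mulr_gt0; lra.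
have [C C0 HC] := powR_dist_le q0 eps0.
exists (C * (p * q)); first by rewrite mulr_ge0// ltW.
move=> a b a0 b0; have := HC (a `^ (p / q)) b (powR_ge0 _ _) b0.
have -> : (a `^ (p / q)) `^ q = a `^ p.
  by rewrite -powRrM divfK// gt_eqF.
have -> : (a `^ (p / q)) `^ (q / 2) = a `^ (p / 2).
  by rewrite -powRrM mulrA divfK// gt_eqF.
have := young_refined a0 b0 p1 q1 pq.
rewrite mulrC ler_pdivrMr// => h1 h2.
have h3 := ler_wpM2l C0 h1.
rewrite -lerBrDr; apply: (le_trans h2); rewrite -subr_ge0 in h3.
rewrite -subr_ge0; apply: le_trans h3 _; rewrite le_eqVlt; apply/orP; left.
by apply/eqP; ring.
Qed.

End pointwise.

(** * Elements of [Lc] through almost-everywhere representatives *)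

Section Lc_ae.
Context d (T : measurableType d) (R : realType).
Variables (mu : {measure set T -> \bar R}) (r : R) (r1 : 1 < r).
Implicit Types u v : Lc mu r1.
Local Notation C := (Rcomplex R).

Lemma Lc_fun_measurable u : cmeasurable u.
Proof. exact: Lcfun_measurable. Qed.

Lemma Lc_ext u v : (u : T -> C) = v %[ae mu] -> u = v.
Proof. by move=> uv; rewrite -[u]reprK -[v]reprK; apply/Lc_eqP. Qed.

Lemma Lc_class_ae (f : T -> C) (fP : f \in Lcfun_pred mu r1) :
  (Lc_class fP : T -> C) = f %[ae mu].
Proof. exact: (Lc_repr (LcFun fP)). Qed.

Lemma Lc_funB u v :
  ((u - v : Lc mu r1) : T -> C) = (fun x => u x - v x) %[ae mu].
Proof.
have := Lc_repr (repr u - repr v : Lcfun mu r1).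
by rewrite raddfB /= !reprK.
Qed.

Lemma Lc_funZ a u :
  ((a *: u : Lc mu r1) : T -> C) = (fun x => a *: u x) %[ae mu].
Proof. exact: (Lc_repr (a *: repr u : Lcfun mu r1)). Qed.

Lemma Lc_abs_ae u : (Lc_abs u : T -> C) = (fun x => (`|u x|%:C)%C) %[ae mu].
Proof. exact: Lc_class_ae. Qed.

Lemma Lc_norm_poweR u (f : T -> C) : (u : T -> C) = f %[ae mu] ->
  cmeasurable f -> ((`|u| `^ r)%:E = \int[mu]_x (`|f x| `^ r)%:E)%E.
Proof.
have r0 : r != 0 by rewrite gt_eqF// (lt_trans _ r1).
move=> uf mf; rewrite -poweR_EFin -[`|u|]/(Lc_norm u) Lc_normE.
by rewrite (cLnorm_ae uf (Lc_fun_measurable u) mf r0) cLnorm_poweR.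
Qed.

Lemma Lc_norm_abs u : `|Lc_abs u| = `|u|.
Proof.
apply: EFin_inj; rewrite -[LHS]/(Lc_norm _)%:E -[RHS]/(Lc_norm _)%:E.
rewrite (Lc_norm_pi (LcFun (Lc_absP u))) Lc_normE.
by apply: eq_Lnorm => x /=; rewrite normc_real normr_id.
Qed.

End Lc_ae.

(** * Modulus and sign of complex numbers *)

Section modulus.
Context {R : realType}.
Implicit Types z w : Rcomplex R.

Lemma Rcomplex_normM z w : `|(z * w : Rcomplex R)| = `|z| * `|w|.
Proof.
case: z w => [a b] [c e]; rewrite !Defs.normcE /= -sqrtrM ?addr_ge0 ?sqr_ge0//.
by congr Num.sqrt; ring.
Qed.

Lemma csign_norm z : `|csign z| = 1.
Proof.
rewrite /csign; case: eqP => [_|/eqP z0]; last first.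
  by rewrite normcZ ger0_norm ?invr_ge0// mulVf ?normr_eq0.
by rewrite Defs.normcE /= expr1n expr0n addr0 sqrtr1.
Qed.

Lemma csign_scale (a : R) z : 0 < a -> csign (a *: csign z) = csign z.
Proof.
move=> a0; have az : `|a *: csign z| = a.
  by rewrite normcZ csign_norm mulr1 gtr0_norm.
rewrite {1}/csign ifN; last by rewrite -normr_eq0 az gt_eqF.
by rewrite az scalerA mulVf ?gt_eqF// scale1r.
Qed.

Lemma csign_ge0 (a : R) : 0 <= a -> csign (a%:C)%C = 1 :> Rcomplex R.
Proof.
rewrite le_eqVlt => /predU1P[<-|a0]; first by rewrite /csign eqxx.
rewrite /csign -normr_eq0 normc_real gtr0_norm// gt_eqF//.
apply/eqP; rewrite eq_complex /= mulr0 eqxx andbT mulVf ?(gt_eqF a0)//.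
Qed.

End modulus.

(** * Moduli and Mazur maps on the unit sphere *)

Section mazur_theory.
Context d (T : measurableType d) (R : realType).
Variables (mu : {measure set T -> \bar R}).
Local Notation C := (Rcomplex R).

Lemma cmeasurable_abs (f : T -> R) :
  measurable_fun [set: T] f -> cmeasurable (fun x => (f x)%:C%C : C).
Proof. by move=> mf; split => //; exact: measurable_cst. Qed.

Section one_exponent.
Variables (r : R) (r1 : 1 < r).
Implicit Types u v : Lc mu r1.

Lemma measurable_Lc_norm u : measurable_fun [set: T] (fun x => `|u x|).
Proof. exact/cmeasurable_norm/Lc_fun_measurable. Qed.

Lemma Lc_abs_idem u : Lc_abs (Lc_abs u) = Lc_abs u.
Proof.
apply: Lc_ext; apply: filterS2 (Lc_abs_ae u) (Lc_abs_ae (Lc_abs u)).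
by move=> x /(_ I) e1 /(_ I) -> _; rewrite e1 normc_real normr_id.
Qed.

(** The reverse triangle inequality, raised to the power [r] and integrated. It serves to pass
    [Lc_abs z = z] to limits. *)
Lemma Lc_abs_lipschitz u v : `|Lc_abs u - Lc_abs v| <= `|u - v|.
Proof.
have r0 : 0 < r := lt_trans ltr01 r1.
apply: (powR_le_cancel r0); rewrite ?normr_ge0//.
have m1 : cmeasurable (fun x => (`|u x| - `|v x|)%:C%C : C).
  by apply: cmeasurable_abs; apply: measurable_funB; exact: measurable_Lc_norm.
have m2 : cmeasurable (fun x => u x - v x).
  have [mR mI] := Lc_fun_measurable u; have [mR' mI'] := Lc_fun_measurable v.
  rewrite (_ : (fun x => _) = (fun x => u x + (-1 : R) *: v x)); last first.
    by apply/funext => x; rewrite scaleN1r.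
  apply: cmeasurableD => //.
  exact: (cmeasurable_scale (measurable_cst (-1 : R))).
rewrite -lee_fin.
rewrite (Lc_norm_poweR (f := fun x => (`|u x| - `|v x|)%:C%C))//; last first.
  apply: filterS3 (Lc_funB (Lc_abs u) (Lc_abs v)) (Lc_abs_ae u) (Lc_abs_ae v).
  move=> x /(_ I) e /(_ I) e1 /(_ I) e2 _; rewrite e e1 e2.
  by apply/eqP; rewrite eq_complex /= subrr !eqxx.
rewrite (Lc_norm_poweR (Lc_funB u v) m2).
apply: ge0_le_integral => //.
- apply/measurable_EFinP/(measurableT_comp (measurable_powR _)) => //.
  exact: cmeasurable_norm.
- apply/measurable_EFinP/(measurableT_comp (measurable_powR _)) => //.
  exact: cmeasurable_norm.
move=> x _; rewrite lee_fin (ge0_ler_powR (ltW r0)) ?nnegrE//.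
by rewrite normc_real ler_dist_dist.
Qed.

End one_exponent.

Section two_exponents.
Variables (r s : R) (r1 : 1 < r) (s1 : 1 < s).
Implicit Types u v : Lc mu r1.

Lemma mazur_unit u : `|u| = 1 -> mazur s1 u = mazur_sphere s1 u.
Proof.
move=> u1; rewrite /mazur -normr_eq0 u1 oner_eq0.
by rewrite invr1 !scale1r.
Qed.

Lemma mazur_unit_ae u : `|u| = 1 ->
  (mazur s1 u : T -> C) = (fun x => `|u x| `^ (r / s) *: csign (u x)) %[ae mu].
Proof. by move=> u1; rewrite mazur_unit//; exact: Lc_class_ae. Qed.

Lemma mazur_norm1 u : `|u| = 1 -> `|mazur s1 u| = 1.
Proof.
move=> u1; have s0 : s != 0 by rewrite gt_eqF// (lt_trans ltr01).
have : `|mazur s1 u| `^ s = 1.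
  apply: EFin_inj; rewrite (Lc_norm_poweR (mazur_unit_ae u1)); last first.
    by have /Lcfun_predP[] := mazur_sphereP s1 u.
  under eq_integral.
    move=> x _; rewrite normcZ csign_norm mulr1 ger0_norm ?powR_ge0//.
    rewrite -powRrM divfK//; over.
  rewrite -(Lc_norm_poweR (u := u)) ?u1 ?powR1//; first exact: nearW.
  exact: Lc_fun_measurable.
move=> /(congr1 (fun a => a `^ s^-1)); rewrite powR1 -powRrM mulfV//.
by rewrite powRr1.
Qed.

End two_exponents.

(** The exponents multiply, [(r/s)(s/t) = r/t], and the sign survives wherever [u] is nonzero; at
    zeros of [u] both sides vanish. *)
Lemma mazur_comp (r s t : R) (r1 : 1 < r) (s1 : 1 < s) (t1 : 1 < t)
  (u : Lc mu r1) : `|u| = 1 -> mazur t1 (mazur s1 u) = mazur t1 u.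
Proof.
move=> u1; have s0 : s != 0 by rewrite gt_eqF// (lt_trans ltr01).
have t0 : t != 0 by rewrite gt_eqF// (lt_trans ltr01).
have r0 : r != 0 by rewrite gt_eqF// (lt_trans ltr01).
apply: Lc_ext.
apply: filterS3 (mazur_unit_ae t1 (mazur_norm1 s1 u1)) (mazur_unit_ae t1 u1)
  (mazur_unit_ae s1 u1).
move=> x /(_ I) -> /(_ I) -> /(_ I) -> _.
rewrite normcZ csign_norm mulr1 ger0_norm ?powR_ge0// -powRrM mulrA divfK//.
have [->|ux0] := eqVneq (u x) 0.
  by rewrite normr0 powR0 ?scale0r// mulf_neq0 ?invr_neq0.
by rewrite csign_scale// powR_gt0// normr_gt0.
Qed.

End mazur_theory.

(** * Stability of Hoelder's inequality *)

Section hoelder_stability.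
Context d (T : measurableType d) (R : realType).
Variables (mu : {measure set T -> \bar R}).
Variables (p q : R) (p1 : 1 < p) (q1 : 1 < q).
Hypothesis pq : p^-1 + q^-1 = 1.
Implicit Types (u : Lc mu p1) (v : Lc mu q1).
Local Notation C := (Rcomplex R).

Let p0 : 0 < p := lt_trans ltr01 p1.
Let q0 : 0 < q := lt_trans ltr01 q1.

Definition abs_pairing u v : \bar R := (\int[mu]_x (`|u x| * `|v x|)%:E)%E.

Lemma abs_pairingE u v : abs_pairing u v = cLnorm mu 1 (fun x => u x * v x).
Proof.
rewrite cLnormE ?oner_eq0// invr1 poweRe1; last first.
  by apply: integral_ge0 => x _; rewrite lee_fin powR_ge0.
by apply: eq_integral => x _; rewrite powRr1// Rcomplex_normM.
Qed.

Lemma measurable_abs_mul u v :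
  measurable_fun [set: T] (fun x => (`|u x| * `|v x|)%:E).
Proof.
by apply/measurable_EFinP; apply: measurable_funM; exact: measurable_Lc_norm.
Qed.

Lemma abs_pairing_le u v : (abs_pairing u v <= (`|u| * `|v|)%:E)%E.
Proof.
have := hoelder mu (measurable_Lc_norm u) (measurable_Lc_norm v) p0 q0 pq.
rewrite EFinM -[`|u|]/(Lc_norm u) -[`|v|]/(Lc_norm v) !Lc_normE.
apply: le_trans; rewrite Lnorm1 le_eqVlt; apply/orP; left; apply/eqP.
by apply: eq_integral => x _; rewrite /= ger0_norm// mulr_ge0.
Qed.

Lemma abs_pairing_scale (a b : R) u v : 0 <= a -> 0 <= b ->
  abs_pairing (a *: u) (b *: v) = ((a * b)%:E * abs_pairing u v)%E.
Proof.
move=> a0 b0; rewrite -ge0_integralZl_EFin ?mulr_ge0//; last first.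
  exact: measurable_abs_mul.
apply: ge0_ae_eq_integral => //.
- exact: measurable_abs_mul.
- by apply/measurable_EFinP; apply: measurable_funM => //;
    apply/measurable_EFinP; exact: measurable_abs_mul.
- by move=> x _; rewrite lee_fin !mulr_ge0.
apply: filterS2 (Lc_funZ a u) (Lc_funZ b v) => x /(_ I) e1 /(_ I) e2 _.
by rewrite e1 e2 !normcZ !ger0_norm//= -EFinM mulrACA.
Qed.

Lemma abs_pairing_abs u v : abs_pairing (Lc_abs u) v = abs_pairing u v.
Proof.
apply: ge0_ae_eq_integral => //.
- exact: measurable_abs_mul.
- exact: measurable_abs_mul.
apply: filterS (Lc_abs_ae u) => x /(_ I) e1 _.
by rewrite e1 normc_real normr_id.
Qed.

(** Pointwise [|u| <= |u'| + |u' - u|], then Hoelder for the last term. The additive form avoids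
    subtracting extended reals. *)
Lemma abs_pairing_dist u u' v :
  (abs_pairing u v <= abs_pairing u' v + (`|u' - u| * `|v|)%:E)%E.
Proof.
apply: le_trans (leeD2l _ (abs_pairing_le (u' - u) v)).
rewrite -ge0_integralD//; first last.
- exact: measurable_abs_mul.
- exact: measurable_abs_mul.
apply: ae_ge0_le_integral => //.
- exact: measurable_abs_mul.
- by move=> x _; rewrite adde_ge0// lee_fin mulr_ge0.
- by apply: emeasurable_funD; exact: measurable_abs_mul.
apply: filterS (Lc_funB u' u) => x /(_ I) e _.
rewrite -EFinD lee_fin e -mulrDl ler_wpM2r//.
by rewrite distrC -lerBlDl lerB_dist.
Qed.

(** The pointwise defect inequality is integrated for [|u|] and [|v|]. The condition [Lc_abs u = u]
    makes the sign of [u] equal to 1 almost everywhere, so that the Mazur image is [|u|^(p/q)]. *)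
Lemma hoelder_stability eps : 0 < eps -> exists2 eta : R, 0 < eta &
  forall u v, `|u| = 1 -> `|v| = 1 -> Lc_abs u = u ->
    ((1 - eta)%:E <= abs_pairing u v)%E ->
    `|mazur q1 u - Lc_abs v| < eps.
Proof.
move=> eps0; have eq0 : 0 < eps `^ q by exact: powR_gt0.
have eps40 : 0 < eps `^ q / 4 by rewrite divr_gt0.
have [D D0 HD] := hoelder_defect_pointwise p1 q1 pq eps40.
have D1 : 0 < 4 * (D + 1) by lra.
(* Chosen so that [D eta <= eps^q / 4]; the [+ 1] keeps the denominator positive when [D = 0]. *)
exists (eps `^ q / (4 * (D + 1))); first by rewrite divr_gt0.
move=> u v u1 v1 uabs; set eta := _ / _ => uv.
have eta0 : 0 < eta by rewrite divr_gt0.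
have De : D * eta <= eps `^ q / 4.
  by rewrite /eta mulrA ler_pdivrMr//; lra.
pose w x : C := (`|u x| `^ (p / q) - `|v x|)%:C%C.
have wae : ((mazur q1 u - Lc_abs v : Lc mu q1) : T -> C) = w %[ae mu].
  have uae : (u : T -> C) = (fun x => (`|u x|%:C)%C) %[ae mu].
    by move: (Lc_abs_ae u); rewrite uabs.
  have mae : (mazur q1 u : T -> C) =
      (fun x => (`|u x| `^ (p / q))%:C%C) %[ae mu].
    apply: filterS2 (mazur_unit_ae q1 u1) uae => x /(_ I) -> /(_ I) e _.
    rewrite {2}e csign_ge0//.
    by apply/eqP; rewrite eq_complex /= mulr1 mulr0 !eqxx.
  apply: filterS3 (Lc_funB (mazur q1 u) (Lc_abs v)) mae (Lc_abs_ae v).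
  move=> x /(_ I) -> /(_ I) -> /(_ I) -> _.
  by apply/eqP; rewrite eq_complex /= subrr !eqxx.
have mw : cmeasurable w.
  apply: cmeasurable_abs; apply: measurable_funB.
    by apply: (measurableT_comp (measurable_powR _)); exact: measurable_Lc_norm.
  exact: measurable_Lc_norm.
have mp (r : R) (f : T -> C) : cmeasurable f ->
    measurable_fun [set: T] (fun x => (`|f x| `^ r)%:E).
  move=> mf; apply/measurable_EFinP/(measurableT_comp (measurable_powR _)) => //.
  exact: cmeasurable_norm.
have mu_ := mp p _ (Lc_fun_measurable u).
have mv_ := mp q _ (Lc_fun_measurable v).
(* Since [u] and [v] have norm 1, the constants on the right are the integrals of the corresponding
   multiples of [|u|^p] and [|v|^q]. *)
have key : ((`|mazur q1 u - Lc_abs v| `^ q)%:E + D%:E * abs_pairing u v <=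
   (eps `^ q / 4 + D / p)%:E + (eps `^ q / 4 + D / q)%:E)%E.
  have intZ (r : R) (r1 : 1 < r) (z : Lc mu r1) (c : R) : 0 <= c -> `|z| = 1 ->
      (c%:E = \int[mu]_x (c%:E * (`|z x| `^ r)%:E))%E.
    move=> c0 z1; have mz := Lc_fun_measurable z.
    rewrite ge0_integralZl_EFin//; last exact: mp.
    by rewrite -(Lc_norm_poweR (u := z))// ?z1 ?powR1 ?mule1//; exact: nearW.
  have cp0 : 0 <= eps `^ q / 4 + D / p.
    by apply: addr_ge0; [exact: ltW|apply: divr_ge0 => //; exact: ltW].
  have cq0 : 0 <= eps `^ q / 4 + D / q.
    by apply: addr_ge0; [exact: ltW|apply: divr_ge0 => //; exact: ltW].
  rewrite (intZ _ _ u _ cp0 u1) (intZ _ _ v _ cq0 v1).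
  rewrite (Lc_norm_poweR wae mw) -ge0_integralZl_EFin//; last first.
    exact: measurable_abs_mul.
  have mwq := mp q _ mw.
  have mDuv := measurable_funeM D%:E (measurable_abs_mul u v).
  have mcu := measurable_funeM (eps `^ q / 4 + D / p)%:E mu_.
  have mcv := measurable_funeM (eps `^ q / 4 + D / q)%:E mv_.
  rewrite -!ge0_integralD//; first last.
  - by move=> x _; rewrite mule_ge0// lee_fin ?mulr_ge0.
  - by move=> x _; rewrite mule_ge0// lee_fin ?powR_ge0.
  - by move=> x _; rewrite mule_ge0// lee_fin ?powR_ge0.
  apply: ge0_le_integral => //.
  - by move=> x _; rewrite -EFinM -EFinD lee_fin addr_ge0 ?powR_ge0// !mulr_ge0.
  - exact: emeasurable_funD.
  - exact: emeasurable_funD.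
  move=> x _; rewrite -!EFinM -!EFinD lee_fin normc_real distrC.
  exact: HD.
have : ((`|mazur q1 u - Lc_abs v| `^ q)%:E + (D * (1 - eta))%:E <=
   (eps `^ q / 4 + D / p)%:E + (eps `^ q / 4 + D / q)%:E)%E.
  by apply: le_trans key; rewrite leeD2l// EFinM lee_wpmul2l.
rewrite -!EFinD lee_fin => {}key.
have DD : D / p + D / q = D by rewrite -mulrDr pq mulr1.
(* Otherwise [eps^q <= eps^q / 2 + D eta <= 3 eps^q / 4]. *)
rewrite ltNge; apply/negP => le.
have : eps `^ q <= `|mazur q1 u - Lc_abs v| `^ q.
  by rewrite (ge0_ler_powR (ltW q0)) ?nnegrE ?(ltW eps0).
lra.
Qed.

End hoelder_stability.

(** * The uniform constant, by compactness *)

Lemma conjugate_inv (R : realType) (p : R) : 1 < p ->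
  p^-1 + (p / (p - 1))^-1 = 1.
Proof. by move=> p1; field; apply/andP; split; rewrite gt_eqF//; lra. Qed.

Theorem theorem4p1 (R : realType) (d : measure_display) (X : measurableType d)
    (mu : {measure set X -> \bar R})
    (X_nonempty : [set: X] !=set0)
    (mu_nonzero : exists2 A : set X, measurable A & mu A != 0%E)
    (p : R) (p1 : 1 < p)
    (C1 : set (Lc mu p1)) (C2 : set (Lc mu (conjugate_gt1 p1))) :
  is_cone C1 -> is_cone C2 ->
  compact (closure (Lc_abs @` C1) `&` unit_sphere (Lc mu p1)) ->
  (mazur (gt1_2 R) @` closure (Lc_abs @` C1)) `&`
    (mazur (gt1_2 R) @` closure (Lc_abs @` C2)) = [set 0] ->
  exists2 gamma : R, 0 <= gamma < 1 &
    forall (f : Lc mu p1) (g : Lc mu (conjugate_gt1 p1)), C1 f -> C2 g ->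
      (cLnorm mu 1 (fun x => (f x * g x)%R) <= (gamma * `|f| * `|g|)%:E)%E.
Proof.
move=> cone1 cone2 K disj; apply: contrapT => nogamma.
pose q1 := conjugate_gt1 p1; have pq := conjugate_inv p1.
pose A (eta : R) := [set z : Lc mu p1 |
  [/\ (Lc_abs @` C1) z, `|z| = 1, Lc_abs z = z &
    exists v : Lc mu q1, [/\ C2 v, `|v| = 1 &
      ((1 - eta)%:E <= abs_pairing z v)%E]]].
have A0 eta : 0 < eta -> A eta !=set0.
  move=> eta0; apply: contrapT => noA; apply: nogamma.
  (* The maximum with 0 covers [eta > 1]. *)
  exists (Num.max 0 (1 - eta)).
    by rewrite le_max lexx /= gt_max ltr01 gtrBl eta0.
  move=> f g C1f C2g; rewrite -abs_pairingE leNgt; apply/negP => lt.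
  have m0 : 0 <= Num.max 0 (1 - eta) by rewrite le_max lexx.
  (* A pair violating the bound has nonzero norms, by Hoelder, so both members can be normalized
     inside their cones. *)
  have fg0 : 0 < `|f| * `|g|.
    rewrite lt_neqAle mulr_ge0// andbT; apply/eqP => fg.
    move: lt; apply/negP; rewrite -leNgt -mulrA -fg mulr0 fg.
    exact: abs_pairing_le.
  have f0 : 0 < `|f|.
    rewrite lt_neqAle normr_ge0 andbT; apply/eqP => f0.
    by move: fg0; rewrite -f0 mul0r ltxx.
  have g0 : 0 < `|g| by move: fg0; rewrite pmulr_rgt0.
  apply: noA; exists (Lc_abs (`|f|^-1 *: f)); split.
  - by exists (`|f|^-1 *: f) => //; apply: cone1; rewrite ?invr_gt0.
  - by rewrite Lc_norm_abs normrZ ger0_norm ?invr_ge0// mulVf// gt_eqF.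
  - exact: Lc_abs_idem.
  exists (`|g|^-1 *: g); split.
  - by apply: cone2; rewrite ?invr_gt0.
  - by rewrite normrZ ger0_norm ?invr_ge0// mulVf// gt_eqF.
  rewrite abs_pairing_abs abs_pairing_scale ?invr_ge0// -invfM.
  rewrite muleC lee_pdivlMr// -EFinM; apply: ltW; apply: le_lt_trans lt.
  by rewrite lee_fin -mulrA ler_wpM2r ?le_max ?lexx ?orbT// ltW.
(* The sets [A eta] shrink with [eta] and are nonempty for [eta > 0]; the filter they generate
   replaces a sequence of approximants. *)
pose F := filter_from [set eta : R | 0 < eta] A.
have FF : ProperFilter F.
  apply: filter_from_proper; last by move=> eta; exact: A0.
  apply: filter_from_filter; first by exists 1; rewrite /= ltr01.
  move=> a b /= a0 b0; exists (Num.min a b); first by rewrite /= lt_min a0.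
  have le_A c : Num.min a b <= c -> A (Num.min a b) `<=` A c.
    move=> le z [? ? ? [v [? ? h]]]; split=> //; exists v; split=> //.
    by apply: le_trans h; rewrite lee_fin lerB.
  by move=> z Az; split; apply: le_A Az; rewrite ge_min lexx ?orbT.
have FK : F (closure (Lc_abs @` C1) `&` unit_sphere (Lc mu p1)).
  exists 1 => /=; first exact: ltr01.
  by move=> z [Cz z1 _ _]; split => //; exact: subset_closure.
have [w [[Cw w1] clw]] := K F FF FK.
have near_w eta eps : 0 < eta -> 0 < eps -> exists2 z, A eta z & `|w - z| < eps.
  move=> eta0 eps0.
  have FA : F (A eta) by exists eta.
  have [z [Az wz]] := clw _ _ FA (nbhsx_ballx w eps eps0).
  by exists z => //; move: wz; rewrite -ball_normE.
(* Being its own modulus is a closed condition: [w] and [Lc_abs w] both lie within [e / 2] of the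
   same [z]. *)
have absw : Lc_abs w = w.
  apply/eqP; rewrite -subr_eq0 -normr_le0; apply/ler_addgt0Pr => e e0.
  rewrite add0r.
  have [z [_ _ zabs _] wz] := near_w 1 (e / 2) ltr01 (divr_gt0 e0 (ltr0n _ 2)).
  have := Lc_abs_lipschitz w z; rewrite zabs => h.
  rewrite -(subrKA z) (le_trans (ler_normD _ _))//.
  by rewrite (distrC z w); lra.
have Cmw : closure (Lc_abs @` C2) (mazur q1 w).
  move=> B /nbhs_ballP[e /= e0 eB].
  have [eta eta0 st] := hoelder_stability mu p1 q1 pq e0.
  have eta20 : 0 < eta / 2 by rewrite divr_gt0.
  (* Half of [eta] absorbs the defect of the pair [(z, v)], the other half the replacement of [z] by
     [w]. *)
  have [z [_ _ _ [v [C2v v1 zv]]] wz] := near_w _ _ eta20 eta20.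
  exists (Lc_abs v); split; first by exists v.
  apply: eB; rewrite -ball_normE /=; apply: st => //.
  have := abs_pairing_dist pq z w v; rewrite v1 mulr1 => h.
  have {}h := le_trans zv h.
  rewrite -leeBlDr// in h; apply: le_trans h.
  by rewrite -EFinB lee_fin; lra.
(* By composition of Mazur maps, [w] and its image in [L^q] give the same point of [L^2], which must
   be 0 although its norm is 1. *)
have : [set 0] (mazur (gt1_2 R) w).
  rewrite -disj; split; first by exists w.
  by exists (mazur q1 w) => //; exact: mazur_comp.
move=> /= m0; have := mazur_norm1 (gt1_2 R) w1.
by rewrite m0 normr0 => /esym/eqP; rewrite oner_eq0.
Qed.
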